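(* Let $V$ be a finite-dimensional diffeological vector space and let $V_1$ be its maximal isotropic subspace. The characteristic quotient $V/V_1$ is diffeomorphic to the diffeological dual $V^*$ (and so to any characteristic subspace of $V$), and $V$ is diffeomorphic to the direct sum $V/V_1\oplus V_1$. Furthermore, any pseudo-metric on $V$ descends to a well-defined scalar product on $V/V_1$. (Diffeomorphisms here are as diffeological vector spaces, i.e. linear.)
   Context: A diffeological space is a set $X$ with a collection of maps (plots) $U\to X$, for $U$ open in $\mathbb{R}^n$, $n\in\mathbb{N}$, such that: constant maps are plots; the composition of a plot with an ordinary smooth map between open sets of Euclidean spaces is a plot; a map that is locally a plot is a plot. A map $f:X\to Y$ is smooth if $f\circ p$ is a plot of $Y$ for every plot $p$ of $X$; a diffeomorphism is a smooth bijection with smooth inverse. A diffeological vector space is a real vector space with a diffeology for which addition and scalar multiplication are smooth (products carry the product diffeology, $\mathbb{R}$ its standard diffeology). The direct sum of finitely many diffeological vector spaces carries the product diffeology; a subspace carries the subset diffeology (its plots are the plots of $V$ with image in it); a quotient carries the quotient diffeology (plots are the maps that locally lift to plots of $V$). The diffeological dual $V^*$ is the vector space of all smooth linear maps $V\to\mathbb{R}$ with the functional diffeology: $p:U\to V^*$ is a plot iff $(u,v)\mapsto p(u)(v)$ is smooth on $U\times V$. A diffeological pseudo-metric on $V$ of finite dimension $n$ is a smooth symmetric semi-positive definite bilinear form $g:V\times V\to\mathbb{R}$ whose maximal isotropic subspace ($\{v\in V: g(v,w)=0\ \forall w\in V\}$) has dimension exactly $n-\dim(V^* )$. Pseudo-metrics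 always exist, and all pseudo-metrics on $V$ have the same maximal isotropic subspace $V_1$, called the maximal isotropic subspace of $V$; it equals the intersection of the kernels of all smooth linear functions $V\to\mathbb{R}$. The characteristic quotient of $V$ is $V/V_1$ with the quotient diffeology. A characteristic subspace of $V$ is obtained by choosing a basis of $V$ (identifying $V$ with $\mathbb{R}^n$) and a pseudo-metric $g$, with matrix $A$ in that basis, and taking the subspace of $V$ generated by the vectors whose coordinates are eigenvectors of $A$ belonging to its positive eigenvalues. *)

(* Defs.v *)
From HB Require Import structures.
From mathcomp Require Import all_boot all_order all_algebra.
From mathcomp Require Import all_classical all_reals all_analysis.

Set Implicit Arguments.
Unset Strict Implicit.
Unset Printing Implicit Defensive.

Import Order.TTheory GRing.Theory Num.Theory.
Import numFieldNormedType.Exports.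

Local Open Scope classical_set_scope.
Local Open Scope ring_scope.

Section Smooth.
Variable R : realType.

(* For open [U], [Ck k U f] says that [f] is of class C^k on [U]. Maps are total
   and only their values on [U] matter, see [Ck_ext]. *)
Fixpoint Ck (m : nat) (W : normedModType R) (k : nat) (U : set 'rV[R]_m)
    (f : 'rV[R]_m -> W) : Prop :=
  if k is k'.+1 then
    (forall x, U x -> differentiable f x) /\ forall v, Ck k' U ('D_v f)
  else forall x, U x -> {for x, continuous f}.

Definition Cinfty (m : nat) (W : normedModType R) (U : set 'rV[R]_m)
  (f : 'rV[R]_m -> W) : Prop := forall k, Ck k U f.

Lemma near_eq_differentiable (V W : normedModType R) (f g : V -> W) x :
  {near x, f =1 g} -> differentiable f x -> differentiable g x.
Proof.
move=> fg df.
have fgx : f x = g x by exact: nbhs_singleton fg.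
have gE : g \o shift x = cst (g x) + 'd f x +o_ 0 id.
  apply/eqaddoP => _/posnumP[e].
  have /eqaddoP/(_ e%:num) := diff_locally df.
  move=> /(_ ltac:(by [])) H.
  have fg0 : \forall h \near (0 : V), f (h + x) = g (h + x).
    by move: fg; rewrite (near_shift 0)/= subr0.
  near=> h.
  have -> : (g \o shift x - (cst (g x) + 'd f x)) h =
            (f \o shift x - (cst (f x) + 'd f x)) h.
    rewrite !fctE /= fgx; congr (_ - _); apply/esym; near: h; exact: fg0.
  by near: h.
apply/diff_locallyP.
have dE : 'd g x = 'd f x :> (V -> W).
  apply: diff_unique gE.
  exact: diff_continuous df.
by rewrite dE; split => //; exact: diff_continuous df.
Unshelve. all: by end_near. Qed.

Lemma Ck_ext m (W : normedModType R) k (U : set 'rV[R]_m) (f g : 'rV[R]_m -> W) :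
  open U -> (forall x, U x -> f x = g x) -> Ck k U f -> Ck k U g.
Proof.
move=> oU; elim: k f g => [|k IHk] f g fg.
  move=> /= cf x Ux; rewrite /prop_for /continuous_at -(fg x Ux).
  have fgx : {near x, f =1 g}.
    by near=> y; apply: fg; near: y; exact: open_nbhs_nbhs.
  exact: cvg_trans (near_eq_cvg fgx) (cf x Ux).
move=> [df Df]; split=> [x Ux|v].
  apply: near_eq_differentiable (df x Ux).
  by near=> y; apply: fg; near: y; exact: open_nbhs_nbhs.
apply: IHk (Df v) => x Ux; apply: near_eq_derive.
by near=> y; apply: fg; near: y; exact: open_nbhs_nbhs.
Unshelve. all: by end_near. Qed.

Lemma Ck_subset m (W : normedModType R) k (U U' : set 'rV[R]_m) (f : 'rV[R]_m -> W) :
  U' `<=` U -> Ck k U f -> Ck k U' f.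
Proof.
move=> U'U; elim: k f => [|k IHk] f /=; first by move=> cf x /U'U/cf.
by move=> [df Df]; split=> [x /U'U/df//|v]; exact: IHk.
Qed.

Lemma Ck_local m (W : normedModType R) k (U : set 'rV[R]_m) (f : 'rV[R]_m -> W) :
  (forall x, U x -> exists2 U' : set 'rV[R]_m, U' x & Ck k U' f) -> Ck k U f.
Proof.
elim: k f => [|k IHk] f /= H; first by move=> x /H[U' U'x cf]; exact: cf.
split=> [x /H[U' U'x [df _]]|v]; first exact: df.
by apply: IHk => x /H[U' U'x [_ /(_ v)]]; exists U'.
Qed.

Lemma CkW m (W : normedModType R) k (U : set 'rV[R]_m) (f : 'rV[R]_m -> W) :
  Ck k.+1 U f -> Ck k U f.
Proof.
elim: k f => [|k IHk] f [df Df].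
  by move=> x Ux; apply: differentiable_continuous; exact: df.
by split=> // v; exact: IHk.
Qed.

Lemma Ck_cst m (W : normedModType R) k (U : set 'rV[R]_m) (w : W) :
  Ck k U (fun=> w).
Proof.
elim: k w => [|k IHk] w; first by move=> x _; exact: cst_continuous.
split=> [x _|v]; first exact: differentiable_cst.
suff -> : (fun x => 'D_v (fun=> w) x) = fun=> 0 by exact: IHk.
by apply/funext => x; exact: derive_cst.
Qed.

Lemma Ck_id m k (U : set 'rV[R]_m) : Ck k U (id : 'rV[R]_m -> _).
Proof.
case: k => [|k]; first by move=> x _; exact: cvg_id.
split=> [x _|v]; first exact: ex_diff.
suff -> : (fun x => 'D_v id x) = fun=> v by exact: Ck_cst.
by apply/funext => x; exact: derive_id.
Qed.

Lemma CkD m (W : normedModType R) k (U : set 'rV[R]_m) (f g : 'rV[R]_m -> W) :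
  open U -> Ck k U f -> Ck k U g -> Ck k U (fun x => f x + g x).
Proof.
move=> oU; elim: k f g => [|k IHk] f g.
  by move=> cf cg x Ux; exact: (continuousD (cf x Ux) (cg x Ux)).
move=> [df Df] [dg Dg]; split=> [x Ux|v].
  by apply: differentiableD; [exact: df|exact: dg].
apply: Ck_ext (IHk _ _ (Df v) (Dg v)) => // x Ux.
by rewrite deriveD//; apply: diff_derivable; [exact: df|exact: dg].
Qed.

Lemma scaler_bilinear (W : normedModType R) : bilinear_for
  (GRing.Scale.Law.clone _ _ *:%R _) (GRing.Scale.Law.clone _ _ *:%R _)
  ( *:%R : R -> W -> W).
Proof.
split=> [w|a] c x y /=; first by rewrite scalerDl scalerA.
by rewrite scalerDr !scalerA mulrC.
Qed.

Lemma is_diffZf (V W : normedModType R) (a : V -> R) (f : V -> W) x :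
  differentiable a x -> differentiable f x ->
  is_diff x (fun y => a y *: f y)
    (fun v => a x *: 'd f x v + 'd a x v *: f x).
Proof.
move=> da df.
pose bM := bilinear_isBilinear.Build R R W W _ _ ( *:%R : R -> W -> W) (scaler_bilinear W).
pose b : {bilinear R -> W -> W} := HB.pack ( *:%R : R -> W -> W) bM.
have cb : continuous (fun p : R * W => b p.1 p.2) by exact: scale_continuous.
have db := differentiable_bilin (a x, f x) cb.
have dp := differentiable_pair da df.
have -> : (fun y => a y *: f y) = (fun p => b p.1 p.2) \o (fun y => (a y, f y)) by [].
apply: DiffDef; first exact: differentiable_comp.
by rewrite diff_comp// diff_bilin// diff_pair.
Qed.

Lemma CkZ m (W : normedModType R) k (U : set 'rV[R]_m)
    (a : 'rV[R]_m -> R) (f : 'rV[R]_m -> W) :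
  open U -> Ck k U a -> Ck k U f -> Ck k U (fun x => a x *: f x).
Proof.
move=> oU; elim: k a f => [|k IHk] a f.
  by move=> ca cf x Ux; exact: (cvgZ (ca x Ux) (cf x Ux)).
move=> ca cf; have [da Da] := ca; have [df Df] := cf; split=> [x Ux|v].
  by have [] := is_diffZf (da x Ux) (df x Ux).
have cDf := IHk _ _ (CkW ca) (Df v).
have cDa := IHk _ _ (Da v) (CkW cf).
apply: Ck_ext (CkD oU cDf cDa) => // x Ux.
have [dZ DZ] := is_diffZf (da x Ux) (df x Ux).
by rewrite !deriveE ?DZ//; [exact: da|exact: df].
Qed.

Lemma Ck_sum m (W : normedModType R) k (U : set 'rV[R]_m) (I : Type) (r : seq I)
    (f : I -> 'rV[R]_m -> W) :
  open U -> (forall i, Ck k U (f i)) -> Ck k U (fun x => \sum_(i <- r) f i x).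
Proof.
move=> oU cf; elim: r => [|i r IHr].
  by under eq_fun do rewrite big_nil; exact: Ck_cst.
by under eq_fun do rewrite big_cons; exact: CkD.
Qed.

Lemma Ck_coord m n k (U : set 'rV[R]_m) (f : 'rV[R]_m -> 'rV[R]_n) i j :
  open U -> Ck k U f -> Ck k U (fun x => f x i j).
Proof.
move=> oU; elim: k f => [|k IHk] f.
  move=> cf x Ux; apply: (@continuous_comp _ _ _ f (fun M : 'rV[R]_n => M i j)).
    exact: cf.
  exact: coord_continuous.
move=> [df Df]; split=> [x Ux|v].
  apply: (@differentiable_comp _ _ _ _ f (fun M : 'rV[R]_n => M i j)).
    exact: df.
  exact: differentiable_coord.
apply: Ck_ext (IHk _ (Df v)) => // x Ux.
have c_lin : linear (fun N : 'rV[R]_n => N i j : R) by move=> a M N; rewrite !mxE.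
pose cM := GRing.isLinear.Build _ _ _ _ _ c_lin.
pose c : {linear 'rV[R]_n -> R} := HB.pack (fun N : 'rV[R]_n => N i j : R) cM.
have dc : differentiable c (f x) by exact: differentiable_coord.
have dcf : differentiable (c \o f) x by apply: differentiable_comp dc; exact: df.
have cE : 'd c (f x) = c :> (_ -> _).
  by apply: diff_lin; exact: coord_continuous.
have dfx := df x Ux.
rewrite -[RHS]/('D_v (c \o f) x) (deriveE _ dcf) (deriveE _ dfx).
rewrite (diff_comp dfx dc).
exact: (esym (congr1 (@^~ ('d f x v)) cE)).
Qed.

Lemma Ck_comp m n (W : normedModType R) k (U : set 'rV[R]_m) (V : set 'rV[R]_n)
    (f : 'rV[R]_m -> 'rV[R]_n) (g : 'rV[R]_n -> W) :
  open U -> f @` U `<=` V -> Ck k U f -> Ck k V g -> Ck k U (g \o f).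
Proof.
move=> oU UV.
have UVx x : U x -> V (f x) by move=> Ux; apply: UV; exists x.
elim: k f g UV UVx => [|k IHk] f g UV UVx.
  by move=> cf cg x Ux; exact: (continuous_comp (cf x Ux) (cg _ (UVx x Ux))).
move=> cf [dg Dg]; have [df Df] := cf; split=> [x Ux|v].
  exact: (differentiable_comp (df x Ux) (dg _ (UVx x Ux))).
have Dcomp : Ck k U (fun x => \sum_(i < n) ('D_v f x) 0 i *: ('D_('e_i) g \o f) x).
  apply: Ck_sum => // i; apply: CkZ => //; first exact: (Ck_coord 0 i oU (Df v)).
  exact: (IHk _ _ UV UVx (CkW cf) (Dg _)).
apply: Ck_ext Dcomp => // x Ux.
have dfx := df x Ux; have dgx := dg _ (UVx _ Ux).
rewrite [RHS](deriveE _ (differentiable_comp dfx dgx)).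
rewrite (diff_comp dfx dgx)/= -(deriveE _ dfx) [X in 'd g _ X]row_sum_delta linear_sum.
apply: eq_bigr => i _; rewrite linearZ; congr (_ *: _).
exact: (deriveE _ dgx).
Qed.

Lemma Cinfty_ext m (W : normedModType R) (U : set 'rV[R]_m) (f g : 'rV[R]_m -> W) :
  open U -> (forall x, U x -> f x = g x) -> Cinfty U f -> Cinfty U g.
Proof. by move=> oU fg cf k; exact: Ck_ext (cf k). Qed.

Lemma Cinfty_local m (W : normedModType R) (U : set 'rV[R]_m) (f : 'rV[R]_m -> W) :
  (forall x, U x -> exists2 U' : set 'rV[R]_m, U' x & Cinfty U' f) -> Cinfty U f.
Proof. by move=> H k; apply: Ck_local => x /H[U' U'x cf]; exists U'. Qed.

Lemma Cinfty_comp m n (W : normedModType R) (U : set 'rV[R]_m) (V : set 'rV[R]_n)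
    (f : 'rV[R]_m -> 'rV[R]_n) (g : 'rV[R]_n -> W) :
  open U -> f @` U `<=` V -> Cinfty U f -> Cinfty V g -> Cinfty U (g \o f).
Proof. by move=> oU UV cf cg k; exact: Ck_comp (cf k) (cg k). Qed.

End Smooth.


(* A plot [U -> X] is represented by a total map [p] from which only the values
   on the open set [U] matter; this is part of [plot_local]. *)
Record diffeology (R : realType) (X : Type) := Diffeology {
  plot : forall n : nat, set 'rV[R]_n -> ('rV[R]_n -> X) -> Prop ;
  plot_open : forall n (U : set 'rV[R]_n) p, plot U p -> open U ;
  plot_cst : forall n (U : set 'rV[R]_n) (a : X),
    open U -> plot U (fun=> a) ;
  plot_comp : forall m n (U : set 'rV[R]_m) (V : set 'rV[R]_n)
      (f : 'rV[R]_m -> 'rV[R]_n) p,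
    plot V p -> open U -> Cinfty U f -> f @` U `<=` V -> plot U (p \o f) ;
  plot_local : forall n (U : set 'rV[R]_n) p, open U ->
    (forall x, U x -> exists V q,
      [/\ V x, V `<=` U, plot V q & forall y, V y -> p y = q y]) ->
    plot U p
}.
Arguments plot {R X} d {n}.

Definition dsmooth (R : realType) (X Y : Type)
    (DX : diffeology R X) (DY : diffeology R Y) (f : X -> Y) : Prop :=
  forall n (U : set 'rV[R]_n) p, plot DX U p -> plot DY U (f \o p).

Section Constructions.
Variable R : realType.

Lemma plot_ext (X : Type) (D : diffeology R X) n (U : set 'rV[R]_n) p q :
  (forall x, U x -> p x = q x) -> plot D U p -> plot D U q.
Proof.
move=> pq Up; apply: plot_local => [|x Ux]; first exact: plot_open Up.
by exists U, p; split=> // y /pq.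
Qed.

Lemma plot_subset (X : Type) (D : diffeology R X) n (U V : set 'rV[R]_n) p :
  open V -> V `<=` U -> plot D U p -> plot D V p.
Proof.
move=> oV VU Up; apply: (plot_comp (f := id) Up oV) => //.
  by case=> [x _|k]; [exact: cvg_id|exact: Ck_id].
by move=> _ [x Vx <-]; exact: VU.
Qed.

Section Std.
Variable W : normedModType R.

Definition std_plot n (U : set 'rV[R]_n) (p : 'rV[R]_n -> W) := open U /\ Cinfty U p.

Program Definition std_diffeology : diffeology R W := @Diffeology R W std_plot _ _ _ _.
Next Obligation. by move=> n U p []. Qed.
Next Obligation. by move=> n U a oU; split=> // k; exact: Ck_cst. Qed.
Next Obligation.
by move=> m n U V f p [oV cp] oU cf fUV; split=> //; exact: Cinfty_comp cf cp.
Qed.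
Next Obligation.
move=> n U p oU H; split=> //; apply: Cinfty_local => x Ux.
have [V [q [Vx VU [oV cq] pq]]] := H x Ux.
by exists V => //; apply: Cinfty_ext cq => // y /pq.
Qed.

End Std.

Section Prod.
Variables (X Y : Type) (DX : diffeology R X) (DY : diffeology R Y).

Definition prod_plot n (U : set 'rV[R]_n) (p : 'rV[R]_n -> X * Y) :=
  plot DX U (fst \o p) /\ plot DY U (snd \o p).

Program Definition prod_diffeology : diffeology R (X * Y) :=
  @Diffeology R (X * Y) prod_plot _ _ _ _.
Next Obligation. by move=> n U p [/plot_open]. Qed.
Next Obligation. by move=> n U a oU; split; exact: plot_cst. Qed.
Next Obligation.
by move=> m n U V f p [p1 p2] oU cf fUV; split;
  [exact: (plot_comp p1)|exact: (plot_comp p2)].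
Qed.
Next Obligation.
move=> n U p oU H; split; apply: plot_local => // x Ux;
  have [V [q [Vx VU [q1 q2] pq]]] := H x Ux.
  by exists V, (fst \o q); split=> // y Vy /=; rewrite pq.
by exists V, (snd \o q); split=> // y Vy /=; rewrite pq.
Qed.

End Prod.

End Constructions.

Record is_diffeological_vspace (R : realType) (V : lmodType R)
    (D : diffeology R V) : Prop := {
  dvs_add : dsmooth (prod_diffeology D D) D (fun vw => vw.1 + vw.2) ;
  dvs_scale : dsmooth (prod_diffeology (std_diffeology R) D) D
    (fun av => av.1 *: av.2)
}.

Definition linear_diffeomorphic (R : realType) (V W : lmodType R)
    (DV : diffeology R V) (DW : diffeology R W) : Prop :=
  exists (f : {linear V -> W}) (g : {linear W -> V}),
    [/\ cancel f g, cancel g f, dsmooth DV DW f & dsmooth DW DV g].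

Section Subspace.
Variables (R : realType) (V : vectType R) (D : diffeology R V) (U : {vspace V}).

Definition sub_plot n (A : set 'rV[R]_n) (p : 'rV[R]_n -> subvs_of U) :=
  plot D A (vsval \o p).

Program Definition sub_diffeology : diffeology R (subvs_of U) :=
  @Diffeology R (subvs_of U) sub_plot _ _ _ _.
Next Obligation. by move=> n A p /plot_open. Qed.
Next Obligation. by move=> n A a oA; exact: plot_cst. Qed.
Next Obligation.
by move=> m n A B f p Bp oA cf fAB; exact: (plot_comp Bp).
Qed.
Next Obligation.
move=> n A p oA H; apply: plot_local => // x Ax.
have [B [q [Bx BA qP pq]]] := H x Ax.
by exists B, (vsval \o q); split=> // y By /=; rewrite pq.
Qed.

End Subspace.

Section Quotient.
Variables (R : realType) (V : vectType R) (U : {vspace V}).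

Definition quotv : Type := Quotient.quot (pred_of_vspace U).

HB.instance Definition _ := Choice.on quotv.
HB.instance Definition _ := GRing.Zmodule.on quotv.

Definition piv (v : V) : quotv := (\pi_(Quotient.quot (pred_of_vspace U)) v)%qT.

Lemma piv_eq v w : (piv v == piv w) = (v - w \in U).
Proof. by rewrite /piv -Quotient.idealrBE. Qed.

Lemma piv_surj x : exists v, piv v = x.
Proof. by exists (repr x); rewrite /piv reprK. Qed.

Lemma piv_is_zmod_morphism : zmod_morphism piv.
Proof. by move=> v w; rewrite /piv raddfB. Qed.

HB.instance Definition _ :=
  GRing.isZmodMorphism.Build V quotv piv piv_is_zmod_morphism.

Definition quotv_scale (a : R) (x : quotv) : quotv := piv (a *: repr x).

Lemma piv_scale a v : piv (a *: v) = quotv_scale a (piv v).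
Proof.
apply/eqP; rewrite /quotv_scale piv_eq -scalerBr memvZ// -piv_eq.
by rewrite /piv reprK.
Qed.

Fact quotv_scaleA a b x :
  quotv_scale a (quotv_scale b x) = quotv_scale (a * b) x.
Proof. by have [v <-] := piv_surj x; rewrite -!piv_scale scalerA. Qed.
Fact quotv_scale1 : left_id 1 quotv_scale.
Proof. by move=> x; have [v <-] := piv_surj x; rewrite -piv_scale scale1r. Qed.
Fact quotv_scaleDr : right_distributive quotv_scale +%R.
Proof.
move=> a x y; have [[v <-] [w <-]] := (piv_surj x, piv_surj y).
by rewrite -raddfD -!piv_scale -raddfD scalerDr.
Qed.
Fact quotv_scaleDl x : {morph quotv_scale^~ x : a b / a + b}.
Proof.
by move=> a b; have [v <-] := piv_surj x; rewrite -!piv_scale -raddfD scalerDl.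
Qed.

HB.instance Definition _ := GRing.Zmodule_isLmodule.Build R quotv
  quotv_scaleA quotv_scale1 quotv_scaleDr quotv_scaleDl.

Fact piv_is_scalable : scalable piv.
Proof. exact: piv_scale. Qed.

HB.instance Definition _ :=
  GRing.isScalable.Build R V quotv *:%R piv piv_is_scalable.

Variable D : diffeology R V.

Definition quot_plot n (A : set 'rV[R]_n) (p : 'rV[R]_n -> quotv) :=
  open A /\ forall x, A x -> exists B q,
    [/\ B x, B `<=` A, plot D B q & forall y, B y -> p y = piv (q y)].

Program Definition quot_diffeology : diffeology R quotv :=
  @Diffeology R quotv quot_plot _ _ _ _.
Next Obligation. by move=> n A p []. Qed.
Next Obligation.
move=> n A a oA; split=> // x Ax; have [v <-] := piv_surj a.
by exists A, (fun=> v); split=> //; exact: plot_cst.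
Qed.
Next Obligation.
move=> m n A A' f p [oA' pP] oA cf fA; split=> // x Ax.
have [B [q [Bfx BA' qP pq]]] := pP (f x) (fA _ (ex_intro2 _ _ x Ax erefl)).
have oB := plot_open qP.
have oAB : open (A `&` f @^-1` B).
  rewrite openE => y [Ay By]; rewrite /interior.
  near=> z; split; near: z; first exact: open_nbhs_nbhs.
  by apply: (cf 0%N y Ay); exact: open_nbhs_nbhs.
exists (A `&` f @^-1` B), (q \o f); split=> //.
- apply: (plot_comp qP) => // [|_ [y [_ By] <-]//].
  by move=> k; exact: Ck_subset (cf k).
- by move=> y [_ By] /=; rewrite pq.
Unshelve. all: by end_near. Qed.
Next Obligation.
move=> n A p oA H; split=> // x Ax.
have [B [q [Bx BA [oB qP] pq]]] := H x Ax.
have [B' [q' [B'x B'B q'P qq']]] := qP x Bx.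
exists B', q'; split=> //; first exact: subset_trans BA.
by move=> y B'y; rewrite pq ?qq'//; exact: B'B.
Qed.

End Quotient.

Section Generated.
Variables (K : fieldType) (V : vectType K).

Lemma generating_seq (S : set V) : exists X : seq V,
  (forall v, v \in X -> S v) /\ (forall v, S v -> v \in <<X>>%VS).
Proof.
pose P n := `[< exists X : seq V, (forall v, v \in X -> S v) /\ \dim <<X>> = n >].
have P0 : exists n, P n by exists (\dim (<<[::]>> : {vspace V})); apply/asboolP; exists [::].
have Pb n : P n -> (n <= \dim {:V})%N.
  by move=> /asboolP[X [_ <-]]; apply: dimvS; exact: subvf.
case: (ex_maxnP P0 Pb) => n /asboolP[X [XS dX]] nmax.
exists X; split=> // v Sv; apply/negPn/negP => vX.
have : P (\dim <<v :: X>>).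
  apply/asboolP; exists (v :: X); split=> // w.
  by rewrite inE => /orP[/eqP->//|/XS].
move=> /nmax; rewrite -dX span_cons leqNgt => /negP; apply.
rewrite ltn_neqAle dimvS ?addvSr// andbT.
apply/eqP => dE; have /eqP XE : (<<X>> == <[v]> + <<X>>)%VS.
  by rewrite eqEdim addvSr/= dE.
by move: vX; rewrite XE memvE addvSl.
Qed.

Definition generatedv (S : set V) : {vspace V} :=
  <<projT1 (cid (generating_seq S))>>%VS.

Lemma mem_generatedv (S : set V) v : S v -> v \in generatedv S.
Proof. by rewrite /generatedv; case: cid => X [/= _]; exact. Qed.

Lemma generatedv_min (S : set V) (U : {vspace V}) :
  (forall v, S v -> v \in U) -> (generatedv S <= U)%VS.
Proof.
move=> SU; rewrite /generatedv; case: cid => X [/= XS _].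
by apply/span_subvP => v /XS/SU.
Qed.

Lemma generatedv_closed (S : set V) v :
  S 0 -> (forall a u w, S u -> S w -> S (a *: u + w)) ->
  v \in generatedv S -> S v.
Proof.
move=> S0 Slin; rewrite /generatedv; case: cid => X [/= XS _].
move=> vX; rewrite (coord_span (vX : v \in <<in_tuple X>>%VS)).
apply: big_rec => // i w _ Sw.
by apply: Slin => //; apply: XS; exact: mem_nth.
Qed.

End Generated.

Section Dual.
Variables (R : realType) (V : vectType R) (D : diffeology R V).

(* [mem_dualv] shows that generation adds nothing. The dual as a vector space is
   [subvs_of dualv]. *)
Definition dualv : {vspace 'Hom(V, R^o)} :=
  generatedv [set f : 'Hom(V, R^o) | dsmooth D (std_diffeology R) f].

Lemma mem_dualv (f : 'Hom(V, R^o)) :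
  f \in dualv <-> dsmooth D (std_diffeology R) f.
Proof.
split=> [|sf]; last exact: mem_generatedv.
move=> fD; apply: (generatedv_closed _ _ fD) => /=.
  move=> n U p Up; apply: (plot_ext (p := fun=> 0)) => [x _|].
    by rewrite /= lfunE.
  by apply: plot_cst; exact: plot_open Up.
move=> a g h sg sh n U p Up; have oU := plot_open Up.
split=> // k; apply: (Ck_ext (f := fun x => a *: (g (p x) : R) + h (p x))) => //.
  by move=> x _ /=; rewrite add_lfunE scale_lfunE.
apply: CkD => //; last by case: (sh _ _ _ Up).
by apply: CkZ => //; [exact: Ck_cst|case: (sg _ _ _ Up)].
Qed.

(* [p] is a plot iff [(u, v) |-> p u v] is smooth on [U * V]; a plot of [U * V]
   is a pair of a smooth map into [U] and a plot of [V]. *)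
Definition dual_plot n (U : set 'rV[R]_n) (p : 'rV[R]_n -> subvs_of dualv) :=
  open U /\ forall m (A : set 'rV[R]_m) (f : 'rV[R]_m -> 'rV[R]_n) q,
    open A -> Cinfty A f -> f @` A `<=` U -> plot D A q ->
    Cinfty A (fun x => vsval (p (f x)) (q x) : R).

Program Definition dual_diffeology : diffeology R (subvs_of dualv) :=
  @Diffeology R (subvs_of dualv) dual_plot _ _ _ _.
Next Obligation. by move=> n U p []. Qed.
Next Obligation.
move=> n U a oU; split=> // m A f q oA _ _ Aq.
have /mem_dualv sa := subvsP a.
by case: (sa _ _ _ Aq).
Qed.
Next Obligation.
move=> m n U U' f p [oU' pP] oU cf fUV; split=> // l A g q oA cg gAU Aq.
apply: (pP _ _ (f \o g)) => //; first exact: Cinfty_comp gAU cg cf.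
by move=> _ [x Ax <-]; apply: fUV; exists (g x) => //; apply: gAU; exists x.
Qed.
Next Obligation.
move=> n U p oU H; split=> // m A f q oA cf fAU Aq.
apply: Cinfty_local => x Ax.
have [U' [r [U'fx U'U [oU' rP] pr]]] := H (f x) (fAU _ (ex_intro2 _ _ x Ax erefl)).
have oB : open (A `&` f @^-1` U').
  rewrite openE => y [Ay U'y]; rewrite /interior.
  near=> z; split; near: z; first exact: open_nbhs_nbhs.
  by apply: (cf 0%N y Ay); exact: open_nbhs_nbhs.
exists (A `&` f @^-1` U') => //.
apply: (Cinfty_ext (f := fun y => vsval (r (f y)) (q y))) => //.
  by move=> y [_ U'y]; rewrite pr.
apply: rP => //.
- by move=> k; exact: Ck_subset (cf k).
- by move=> _ [y [_ U'y] <-].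
- by apply: plot_subset Aq.
Unshelve. all: by end_near. Qed.

End Dual.

Section PseudoMetric.
Variables (R : realType) (V : vectType R) (D : diffeology R V).

Definition smooth_form (W : lmodType R) (DW : diffeology R W)
    (g : W -> W -> R) : Prop :=
  dsmooth (prod_diffeology DW DW) (std_diffeology R) (fun vw => g vw.1 vw.2).

(* [orthov g fullv] is the subspace of the [v] such that [g v w = 0] for all [w].
   The subtraction does not truncate as [dualv D] is a subspace of
   ['Hom(V, R^o)]. *)
Definition is_pseudo_metric (g : {symmetric V}) : Prop :=
  [/\ smooth_form D g,
      forall v, 0 <= g v v &
      \dim (orthov g fullv) = (\dim {:V} - \dim (dualv D))%N].

(* The isotropic subspace of the pseudo-metrics on [V]: pseudo-metrics exist and
   all have the same isotropic subspace, so the default value is irrelevant. *)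
Definition max_isotropic : {vspace V} :=
  xget 0%VS [set U | exists2 g, is_pseudo_metric g & U = orthov g fullv].

Definition gram_mx (b : (\dim {:V}).-tuple V) (g : V -> V -> R) :
  'M[R]_(\dim {:V}) := \matrix_(i, j) g b`_i b`_j.

Definition coord_col (b : (\dim {:V}).-tuple V) (v : V) : 'cV[R]_(\dim {:V}) :=
  \col_i coord b i v.

Definition characteristic_subspace (b : (\dim {:V}).-tuple V)
    (g : {symmetric V}) : {vspace V} :=
  generatedv [set v | v != 0 /\ exists2 l : R, 0 < l &
    gram_mx b g *m coord_col b v = l *: coord_col b v].

End PseudoMetric.

(* Main.v *)
(* All of the smooth structure of [V] that the theorem sees is carried by its
   dual. Let [f_1, .., f_k] be a basis of the dual and [e_1, .., e_k] vectors with
   [f_i e_j = delta_ij]. A pseudo-metric [g] has [g(_, v)] in the dual for every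
   [v], so by its dimension the isotropic subspace is the common kernel [V1] of
   the [f_i], for instance when [g v w = \sum_i f_i v * f_i w]. A linear map [h]
   that vanishes on [V1] satisfies [h v = \sum_i f_i v *: h e_i], and hence is
   smooth. So every linear map out of [V / V1] is smooth, and so is the projection
   along [V1] onto any complement of [V1], which gives the isomorphisms. That a
   characteristic subspace is such a complement is the spectral theorem for the
   positive semidefinite Gram matrix of [g]. *)
Require Import Defs.
From HB Require Import structures.
From mathcomp Require Import complex.
From mathcomp Require Import all_boot all_order all_algebra.
From mathcomp Require Import all_classical all_reals all_analysis.
From mathcomp Require Import ring.

Set Implicit Arguments.
Unset Strict Implicit.
Unset Printing Implicit Defensive.

Import Order.TTheory GRing.Theory Num.Theory.
Import numFieldNormedType.Exports.

Local Open Scope classical_set_scope.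
Local Open Scope ring_scope.

(** * Linear algebra: symmetric matrices and dual families *)

(* [A] is diagonalized by a unitary matrix over [R[i]] with real eigenvalues, and
   real matrices that are similar over [R[i]] are similar over [R]. *)
Lemma symmetric_diagonalization (R : rcfType) n (A : 'M[R]_n) : A^T = A ->
  exists P : 'M[R]_n, P \in unitmx /\ exists d, P *m A = diag_mx d *m P.
Proof.
move=> A_sym; pose toC := real_complex R; pose AC := map_mx toC A.
have realC x : toC x \is Num.real by apply/complex_realP; exists x.
have AC_real : AC \is a realmx by apply/mxOverP => i j; rewrite mxE.
have AC_herm : AC \is hermsymmx.
  apply: realsym_hermsym => //; apply/is_hermitianmxP.
  by rewrite expr0 scale1r map_mx_id // /AC map_trmx A_sym.
have d_real := hermitian_spectral_diag_real AC_herm.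
have /orthomx_spectralP AC_eq := hermitian_normalmx AC_herm.
have AC_sim : similar_in unitmx AC (diag_mx (spectral_diag AC)).
  exists (spectralmx AC); first exact: spectral_unit.
  apply/similarP; first exact: spectral_unit.
  by rewrite [X in _ *m X]AC_eq !mulmxA mulmxV ?mul1mx ?spectral_unit.
have D_real : diag_mx (spectral_diag AC) \is a realmx.
  apply/mxOverP => i j; rewrite !mxE; case: (i == j); rewrite ?mulr1n ?mulr0n //.
  exact: (mxOverP d_real).
have [P /andP[P_real P_unit]] := real_similar AC_sim AC_real D_real.
have ReK m k (M : 'M[complex R]_(m, k)) : M \is a realmx ->
    map_mx toC (map_mx (@complex.Re R) M) = M.
  by move=> /mxOverP M_real; apply/matrixP => i j; rewrite !mxE; apply: RRe_real.
move=> /(similarP P_unit); rewrite -(ReK _ _ _ P_real) -(ReK _ _ _ d_real).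
rewrite -map_diag_mx -!map_mxM => /map_mx_inj eqP.
exists (map_mx (@complex.Re R) P); split; last first.
  by exists (map_mx (@complex.Re R) (spectral_diag AC)).
by rewrite -(map_unitmx toC) ReK.
Qed.

Lemma mem_vbasis_nth (K : fieldType) (V : vectType K) (U : {vspace V})
    (i : 'I_(\dim U)) : (vbasis U)`_i \in U.
Proof. by apply: vbasis_mem; rewrite mem_nth ?size_tuple. Qed.

(** The matrix [M] of values of the forms on a basis of [V] has independent rows: a relation between
    them is a combination of the forms that vanishes on the basis. So [M] has a right inverse, whose
    columns are the coordinates of the vectors sought. *)
Lemma dual_family (K : fieldType) (V : vectType K) k
    (X : k.-tuple 'Hom(V, K^o)) : free X ->
  exists e : 'I_k -> V, forall i j : 'I_k, X`_i (e j) = (i == j)%:R.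
Proof.
move=> X_free; pose b := vbasis {:V}.
pose M := \matrix_(i < k, l < \dim {:V}) (X`_i b`_l : K).
have M_free : row_free M.
  rewrite -kermx_eq0; apply/rowV0P => u /sub_kermxP uM.
  have uX : \sum_(i < k) u 0 i *: X`_i = 0.
    apply/lfunP => v; rewrite zero_lfunE (coord_vbasis (memvf v)) linear_sum.
    rewrite big1 // => l _; rewrite linearZ /= sum_lfunE.
    have := congr1 (fun N : 'rV[K]_(\dim {:V}) => N 0 l) uM; rewrite !mxE => uMl.
    rewrite [X in _ *: X](_ : _ = 0) ?scaler0 // -[RHS]uMl; apply: eq_bigr => i _.
    by rewrite scale_lfunE mxE.
  by apply/rowP => i; rewrite mxE; move/freeP: X_free => /(_ (u 0) uX i).
exists (fun j => \sum_l pinvmx M l j *: b`_l) => i j.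
have := congr1 (fun N : 'M[K]_k => N i j) (mulmxVp M_free); rewrite !mxE => <-.
rewrite linear_sum; apply: eq_bigr => l _.
by rewrite linearZ !mxE /= [LHS]mulrC.
Qed.

(** * Plots with values in a diffeological vector space *)

Section DiffeologicalVectorSpace.
Context (R : realType) (W : lmodType R) (D : diffeology R W).
Context (hD : is_diffeological_vspace D).

Lemma plotD n (U : set 'rV[R]_n) p q :
  plot D U p -> plot D U q -> plot D U (fun x => p x + q x).
Proof. by move=> pP qP; apply: (dvs_add hD (p := fun x => (p x, q x))). Qed.

Lemma plotZ n (U : set 'rV[R]_n) (a : 'rV[R]_n -> R) p :
  plot (std_diffeology R) U a -> plot D U p -> plot D U (fun x => a x *: p x).
Proof. by move=> aP pP; apply: (dvs_scale hD (p := fun x => (a x, p x))). Qed.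

Lemma plot_sum n (U : set 'rV[R]_n) (I : Type) (r : seq I) p :
  open U -> (forall i, plot D U (p i)) ->
  plot D U (fun x => \sum_(i <- r) p i x).
Proof.
move=> oU pP; elim: r => [|i r IHr].
  by under eq_fun do rewrite big_nil; exact: plot_cst.
by under eq_fun do rewrite big_cons; exact: plotD.
Qed.

End DiffeologicalVectorSpace.

(** * Smooth and linear maps out of a quotient *)

Section Quotient.
Context (R : realType) (V : vectType R) (U : {vspace V}) (D : diffeology R V).

Lemma piv_eq0 v : (piv U v == 0) = (v \in U).
Proof. by rewrite -[in LHS](linear0 (piv U)) piv_eq subr0. Qed.

Lemma dsmooth_piv : dsmooth D (quot_diffeology U D) (piv U).
Proof.
move=> n A p pP; split=> [|x Ax]; first exact: plot_open pP.
by exists A, p; split.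
Qed.

(** Plots of the quotient lift locally to [V], and being a plot of [Y] is a local property. *)
Lemma dsmooth_quot (Y : Type) (DY : diffeology R Y) (f : quotv U -> Y) :
  dsmooth D DY (f \o piv U) -> dsmooth (quot_diffeology U D) DY f.
Proof.
move=> sf n A p [oA pP]; apply: plot_local => // x Ax.
have [B [q [Bx BA qP pq]]] := pP x Ax.
by exists B, (f \o piv U \o q); split=> // [|y By]; [exact: sf|rewrite /= pq].
Qed.

Context (W : lmodType R).

Lemma quot_lift (h : {linear V -> W}) : (forall v, v \in U -> h v = 0) ->
  exists f : {linear quotv U -> W}, forall v, f (piv U v) = h v.
Proof.
move=> hU; pose f (x : quotv U) := h (repr x).
have fE v : f (piv U v) = h v.
  apply/eqP; rewrite -subr_eq0 -linearB hU // -piv_eq.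
  by rewrite /piv reprK.
have f_lin : linear f.
  move=> a x y; have [[v <-] [w <-]] := (piv_surj x, piv_surj y).
  by rewrite -linearP !fE linearP.
pose fM := GRing.isLinear.Build _ _ _ _ f f_lin.
pose f' : {linear quotv U -> W} := HB.pack f fM.
by exists f'.
Qed.

End Quotient.

(** [dsmooth_linear] asks for a target with smooth operations; this lemma and the next supply the
    targets other than [V]. *)
Lemma sub_diffeological_vspace (R : realType) (V : vectType R)
    (D : diffeology R V) (U : {vspace V}) :
  is_diffeological_vspace D -> is_diffeological_vspace (sub_diffeology D U).
Proof.
by move=> hD; split=> n A p [p1 p2]; [exact: (plotD hD p1 p2)|exact: (plotZ hD p1 p2)].
Qed.

Lemma dual_diffeological_vspace (R : realType) (V : vectType R)
    (D : diffeology R V) : is_diffeological_vspace (dual_diffeology D).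
Proof.
split=> n A p [[oA p1] [_ p2]]; split=> // m B f q oB cf fB qP k.
  apply: (Ck_ext (f := fun x =>
    (vsval (p (f x)).1 (q x) : R) + (vsval (p (f x)).2 (q x) : R))) => //.
    by move=> x _; rewrite /= add_lfunE.
  by apply: CkD => //; [exact: (p1 _ _ _ _ _ _ _ qP)|exact: (p2 _ _ _ _ _ _ _ qP)].
apply: (Ck_ext (f := fun x =>
    (p (f x)).1 *: (vsval (p (f x)).2 (q x) : R))) => //.
  by move=> x _; rewrite /= scale_lfunE.
apply: CkZ => //; last exact: (p2 _ _ _ _ _ _ _ qP).
exact: (Cinfty_comp oB fB cf p1).
Qed.

(** * Annihilators of spaces of linear forms *)

Section Annihilator.
Context (K : fieldType) (V : vectType K) (U : {vspace 'Hom(V, K^o)}).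

Definition annv : {vspace V} := (\bigcap_(i < \dim U) lker (vbasis U)`_i)%VS.

Lemma mem_annv v : v \in annv <-> forall f, f \in U -> f v = 0.
Proof.
split=> [/subv_bigcapP vU f fU|vU].
  rewrite (coord_vbasis fU) sum_lfunE big1 // => i _.
  by have := vU i isT; rewrite -memvE memv_ker scale_lfunE => /eqP ->; rewrite scaler0.
apply/subv_bigcapP => i _; rewrite -memvE memv_ker; apply/eqP/vU.
exact: mem_vbasis_nth.
Qed.

(** Rank-nullity for the map [ev] that evaluates a basis of [U]: its kernel is [annv], and it is
    onto because it sends the dual family [e] to the unit vectors. *)
Lemma dim_annv : \dim annv = (\dim {:V} - \dim U)%N.
Proof.
have [e eP] := dual_family (basis_free (vbasisP U)).
pose ev (v : V) := \row_(i < \dim U) ((vbasis U)`_i v : K).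
have ev_lin : linear ev.
  by move=> a v w; apply/rowP => i; rewrite !mxE linearP.
pose evM := GRing.isLinear.Build _ _ _ _ ev ev_lin.
pose ev' : {linear V -> 'rV[K]_(\dim U)} := HB.pack ev evM.
have kerE : lker (linfun ev') = annv.
  apply/vspaceP => v; rewrite memv_ker lfunE /=; apply/eqP/idP.
    move=> /rowP ev0; apply/subv_bigcapP => i _; rewrite -memvE memv_ker.
    by have := ev0 i; rewrite !mxE => ->.
  move=> /mem_annv vU; apply/rowP => i; rewrite !mxE; apply: vU.
  exact: mem_vbasis_nth.
have imE : limg (linfun ev') = fullv.
  apply/vspaceP => c; rewrite memvf; apply/memv_imgP.
  exists (\sum_j c 0 j *: e j); rewrite ?memvf // lfunE /=.
  apply/rowP => i; rewrite mxE linear_sum (bigD1 i) //= big1 => [|j ji].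
    by rewrite addr0 linearZ /= eP eqxx [RHS]mulr1.
  by rewrite linearZ /= eP eq_sym (negPf ji) scaler0.
have := limg_ker_dim (linfun ev') fullv.
by rewrite imE capfv kerE (dimvf 'rV[K]_(\dim U)) dim_matrix => <-; rewrite mul1r addnK.
Qed.

End Annihilator.

(** * Semipositive forms and projections of a direct sum *)

Lemma sform_sym (R : realType) (V : lmodType R) (g : {symmetric V}) v w :
  g v w = g w v.
Proof. by rewrite hermC expr0 mul1r. Qed.

(** If g v v = 0 and g v w is nonzero, then g (a v + w) (a v + w) is affine and not constant in a,
    so it takes negative values. *)
Lemma sform_ge0_isotropic (R : realType) (V : lmodType R) (g : {symmetric V}) :
  (forall v, 0 <= g v v) -> forall v w, g v v = 0 -> g v w = 0.
Proof.
move=> g_ge0 v w gvv; apply/eqP; apply: contraT => gvw.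
(* The coefficient of [v] is chosen so that the form takes the value -1. *)
have := g_ge0 (- (g w w + 1) / (2 * g v w) *: v + w).
set a := _ / _ .
rewrite linearPl !linearPr /= gvv mulr0 (sform_sym g w v).
rewrite (_ : _ + _ = -1) ?ler0N1 // /a.
by field; exact: gvw.
Qed.

Lemma daddv_pi_ker (K : fieldType) (V : vectType K) (U W : {vspace V}) v :
  (U :&: W = 0)%VS -> v \in W -> daddv_pi U W v = 0.
Proof.
move=> UW0 vW; have vUW : v \in (U + W)%VS by apply: subvP vW; exact: addvSr.
have /eqP := daddv_pi_add UW0 vUW.
by rewrite (daddv_pi_id _ vW) 1?capvC // -subr_eq0 addrK => /eqP.
Qed.

(** * Pseudo-metrics and the maximal isotropic subspace *)

Section PseudoMetric.
Context (R : realType) (V : vectType R) (D : diffeology R V).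

Lemma smooth_form_dualv (g : {symmetric V}) v :
  smooth_form D g -> linfun (applyr g v : V -> R^o) \in dualv D.
Proof.
move=> sg; apply/mem_dualv => n U p Up.
apply: plot_ext (sg n U (fun x => (p x, v)) _) => [x _|].
  by rewrite /= lfunE.
by split => //; apply: plot_cst; exact: plot_open Up.
Qed.

(** The forms g(_, w) lie in the dual, so its annihilator is isotropic; the dimensions agree. The
    right side does not depend on [g]. *)
Lemma orthov_pseudo_metric (g : {symmetric V}) :
  is_pseudo_metric D g -> orthov g fullv = annv (dualv D).
Proof.
move=> [sg _ g_dim]; apply/esym/eqP; rewrite eqEdim g_dim dim_annv leqnn andbT.
apply/subvP => v /mem_annv vD; apply/mem_orthovP => w _.
by have := vD _ (smooth_form_dualv w sg); rewrite lfunE.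
Qed.

Lemma pseudo_metric_exists : exists g : {symmetric V}, is_pseudo_metric D g.
Proof.
pose f (i : 'I_(\dim (dualv D))) (v : V) : R := (vbasis (dualv D))`_i v.
have fP i a v w : f i (a *: v + w) = a * f i v + f i w by rewrite /f linearP.
pose g (v w : V) : R := \sum_i f i v * f i w.
have g_sym v w : g v w = (-1) ^+ false * idfun (g w v).
  by rewrite expr0 mul1r /g /=; apply: eq_bigr => i _; rewrite mulrC.
have g_bil : bilinear_for *%R (idfun \; *%R) g.
  split=> v a u w; rewrite /= /g mulr_sumr -big_split; apply: eq_bigr => i _.
    by rewrite fP mulrDl mulrA.
  by rewrite fP mulrDr mulrCA.
pose gB := bilinear_isBilinear.Build _ _ _ _ _ _ g g_bil.
pose gH := isHermitianSesquilinear.Build _ _ false idfun g g_sym.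
pose g' : {symmetric V} := HB.pack g gB gH.
have g_ge0 v : 0 <= g v v by apply: sumr_ge0 => i _; rewrite -expr2 sqr_ge0.
exists g'; split=> //.
  move=> n U p [p1 p2]; have oU := plot_open p1; split=> // k.
  apply: Ck_sum => // i; apply: (CkZ (W := R)) => //.
    by have /mem_dualv/(_ _ _ _ p1)[] := mem_vbasis_nth i.
  by have /mem_dualv/(_ _ _ _ p2)[] := mem_vbasis_nth i.
(* It suffices that the isotropic subspace is the annihilator of the dual. As g v v is the sum of
   the squares of the f_i v, it vanishes only if they all do. *)
rewrite -dim_annv; congr (\dim _); apply/vspaceP => v; apply/idP/idP.
  move=> /mem_orthovP/(_ v (memvf v)) gvv; apply/subv_bigcapP => i _.
  rewrite -memvE memv_ker; have /eqP := gvv; rewrite psumr_eq0; last first.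
    by move=> j _; rewrite -expr2 sqr_ge0.
  by move=> /allP/(_ i (mem_index_enum i)); rewrite /= mulf_eq0 orbb.
move=> /mem_annv vD; apply/mem_orthovP => w _; apply: big1 => i _.
by rewrite /f vD ?mul0r ?mem_vbasis_nth.
Qed.

(** The default value of [xget] is ruled out by the existence of a pseudo-metric. *)
Lemma max_isotropicE : max_isotropic D = annv (dualv D).
Proof.
rewrite /max_isotropic; case: xgetP => [U _ [g pg ->]|H].
  exact: orthov_pseudo_metric.
have [g pg] := pseudo_metric_exists.
by case: (H (orthov g fullv)); exists g.
Qed.

Lemma max_isotropic_orthov (g : {symmetric V}) :
  is_pseudo_metric D g -> max_isotropic D = orthov g fullv.
Proof. by move=> /orthov_pseudo_metric ->; exact: max_isotropicE. Qed.

Lemma mem_max_isotropic v :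
  v \in max_isotropic D <-> forall f, f \in dualv D -> f v = 0.
Proof. by rewrite max_isotropicE; exact: mem_annv. Qed.

(** * Dual bases and smoothness of linear maps *)

Local Notation dbasis := (vbasis (dualv D)).

(** A form in the dual is determined by its values on the dual family, so each one kills the
    remainder of [v]. Thus the e_i span a complement of the maximal isotropic subspace. *)
Lemma dual_expansion : exists e : 'I_(\dim (dualv D)) -> V,
  [/\ forall i j : 'I_(\dim (dualv D)), dbasis`_i (e j) = (i == j)%:R,
      forall f, f \in dualv D -> f = \sum_i f (e i) *: dbasis`_i &
      forall v, v - \sum_(i < \dim (dualv D)) dbasis`_i v *: e i
        \in max_isotropic D].
Proof.
have [e eP] := dual_family (basis_free (vbasisP (dualv D))).
have fE f : f \in dualv D -> f = \sum_i f (e i) *: dbasis`_i.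
  move=> fD; rewrite {1}(coord_vbasis fD); apply: eq_bigr => i _.
  congr (_ *: _); rewrite {2}(coord_vbasis fD) sum_lfunE (bigD1 i) //= big1.
    by rewrite addr0 scale_lfunE eP eqxx [RHS]mulr1.
  by move=> j ji; rewrite scale_lfunE eP (negPf ji) scaler0.
exists e; split=> // v; apply/mem_max_isotropic => f /fE fD.
apply/eqP; rewrite linearB linear_sum subr_eq0; apply/eqP.
rewrite -[LHS]/(f v) [in LHS]fD sum_lfunE; apply: eq_bigr => i _.
by rewrite scale_lfunE linearZ /= [LHS]mulrC.
Qed.

Section Linear.
Context (hD : is_diffeological_vspace D).
Local Notation V1 := (max_isotropic D).

(** As [h] kills the remainder in [dual_expansion], [h \o p] is a combination of the constants
    [h (e i)] with the smooth coefficients f_i (p x). *)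
Lemma dsmooth_linear (W : lmodType R) (DW : diffeology R W) (h : {linear V -> W}) :
  is_diffeological_vspace DW -> (forall v, v \in V1 -> h v = 0) ->
  dsmooth D DW h.
Proof.
move=> hW hV1; have [e [_ _ eP]] := dual_expansion => n U p Up.
have oU := plot_open Up.
apply: (plot_ext (p := fun x =>
  \sum_(i < \dim (dualv D)) dbasis`_i (p x) *: h (e i))).
  move=> x _; have /eqP := hV1 _ (eP (p x)).
  rewrite linearB linear_sum subr_eq0 => /eqP hE.
  by apply/esym; apply: etrans hE _; apply: eq_bigr => i _; rewrite linearZ.
apply: plot_sum => // i; apply: (plotZ hW); last exact: plot_cst.
suff /mem_dualv /(_ _ _ _ Up) : dbasis`_i \in dualv D by [].
exact: mem_vbasis_nth.
Qed.

(** The composite with [piv V1] vanishes on [V1]. For an isomorphism out of the quotient, only the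
    inverse remains to be checked. *)
Lemma dsmooth_linear_quot (W : lmodType R) (DW : diffeology R W)
    (h : {linear quotv V1 -> W}) : is_diffeological_vspace DW ->
  dsmooth (quot_diffeology V1 D) DW h.
Proof.
move=> hW; apply: dsmooth_quot.
apply: (dsmooth_linear (h := h \o piv V1)) => // v vV1 /=.
suff -> : piv V1 v = 0 by rewrite linear0.
by apply/eqP; rewrite piv_eq0.
Qed.

(** * The isomorphisms and the induced scalar product *)

(** The map [ev] is v |-> g(v, _) for the pseudo-metric g v w = \sum_i f_i v * f_i w. The inverse
    sends a form [h] to the class of \sum_i h(e_i) e_i. *)
Lemma quot_diffeomorphic_dual :
  linear_diffeomorphic (quot_diffeology V1 D) (dual_diffeology D).
Proof.
have [e [e_dual fE eP]] := dual_expansion.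
pose ev (v : V) : subvs_of (dualv D) :=
  \sum_(i < \dim (dualv D)) dbasis`_i v *: vsproj (dualv D) dbasis`_i.
have ev_lin : linear ev.
  move=> a v w; rewrite /ev scaler_sumr -big_split; apply: eq_bigr => i _.
  by rewrite linearP scalerDl scalerA.
pose evM := GRing.isLinear.Build _ _ _ _ ev ev_lin.
pose ev' : {linear V -> subvs_of (dualv D)} := HB.pack ev evM.
have [f f_piv] : exists f : {linear quotv V1 -> subvs_of (dualv D)},
    forall v, f (piv V1 v) = ev v.
  apply: (quot_lift (h := ev')) => v /mem_max_isotropic vV1.
  by apply: big1 => i _; rewrite vV1 ?scale0r ?mem_vbasis_nth.
pose g (h : subvs_of (dualv D)) : quotv V1 := \sum_i vsval h (e i) *: piv V1 (e i).
have g_lin : linear g.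
  move=> a h k; rewrite /g scaler_sumr -big_split; apply: eq_bigr => i _.
  by rewrite /= add_lfunE scale_lfunE scalerDl scalerA.
pose gM := GRing.isLinear.Build _ _ _ _ g g_lin.
pose g' : {linear subvs_of (dualv D) -> quotv V1} := HB.pack g gM.
have gE (h : subvs_of (dualv D)) : g h = piv V1 (\sum_i vsval h (e i) *: e i).
  by rewrite linear_sum; apply: eq_bigr => i _; rewrite linearZ.
have evK (h : subvs_of (dualv D)) : ev (\sum_i vsval h (e i) *: e i) = h.
  apply: val_inj; rewrite /= linear_sum [RHS](fE _ (subvsP h)).
  apply: eq_bigr => i _; rewrite linearZ /= vsprojK ?mem_vbasis_nth //; congr (_ *: _).
  rewrite linear_sum (bigD1 i) //= big1 => [|j ji].
    by rewrite addr0 linearZ /= e_dual eqxx [LHS]mulr1.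
  by rewrite linearZ /= e_dual eq_sym (negPf ji) scaler0.
exists f, g'; split.
- move=> x; have [v <-] := piv_surj x; rewrite f_piv /= gE; apply/eqP.
  rewrite eq_sym piv_eq.
  (* The form [ev v] takes the value f_i v at [e i], so the representative is the expansion of [v]
     modulo [V1]. *)
  rewrite (_ : \sum_i _ = \sum_(i < \dim (dualv D)) dbasis`_i v *: e i) //.
  apply: eq_bigr => i _; congr (_ *: _).
  rewrite linear_sum sum_lfunE (bigD1 i) //= big1 => [|j ji].
    by rewrite addr0 scale_lfunE vsprojK ?mem_vbasis_nth // e_dual eqxx [LHS]mulr1.
  by rewrite scale_lfunE vsprojK ?mem_vbasis_nth // e_dual (negPf ji) scaler0.
- by move=> h; rewrite /= gE f_piv evK.
- exact: dsmooth_linear_quot (dual_diffeological_vspace D).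
move=> n U p [oU pP].
apply: (plot_ext (p := piv V1 \o fun x => \sum_i vsval (p x) (e i) *: e i)).
  by move=> x _ /=; rewrite gE.
apply: dsmooth_piv; apply: plot_sum => // i.
apply: (plotZ hD); last exact: plot_cst.
(* The functional diffeology, tested on the identity of [U] and the constant plot [e i], makes the
   coefficient smooth. *)
split=> //; apply: (pP _ U id) => //.
- by move=> k; exact: Ck_id.
- by move=> _ [x Ux <-].
- exact: plot_cst.
Qed.

(** The projection onto [C] along [V1] descends to the quotient; its inverse is [piv V1] restricted
    to [C]. *)
Lemma quot_diffeomorphic_complement (C : {vspace V}) :
  (C :&: V1 = 0)%VS -> (C + V1 = fullv)%VS ->
  linear_diffeomorphic (quot_diffeology V1 D) (sub_diffeology D C).
Proof.
move=> CV1 CDV1; pose pr := vsproj C \o daddv_pi C V1.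
have prV1 v : v \in V1 -> pr v = 0.
  by move=> vV1; rewrite /pr /= daddv_pi_ker // linear0.
have prE v : v - vsval (pr v) \in V1.
  rewrite /= vsprojK ?memv_pi // -{1}(@daddv_pi_add _ _ C V1 v CV1) ?CDV1 ?memvf //.
  by rewrite addrC addrA addNr add0r memv_pi.
have [f f_piv] := quot_lift (h := pr) prV1.
exists f, (piv V1 \o vsval); split.
- move=> x; have [v <-] := piv_surj x; rewrite f_piv; apply/eqP.
  by rewrite eq_sym piv_eq prE.
- move=> c; rewrite /= f_piv; apply: val_inj.
  by rewrite /= daddv_pi_id ?subvsP ?vsprojK ?subvsP.
- exact: dsmooth_linear_quot (sub_diffeological_vspace C hD).
- move=> n U p pP; apply: (dsmooth_piv V1 pP).
Qed.

(** For a complement [C] of [V1], a vector goes to its class and its component in [V1]. The inverse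
    adds to the second entry the representative [f] of the class in [C]. *)
Lemma diffeomorphic_quot_sum :
  linear_diffeomorphic D
    (prod_diffeology (quot_diffeology V1 D) (sub_diffeology D V1)).
Proof.
pose C := (V1^C)%VS.
have V1C : (V1 :&: C = 0)%VS by exact: capv_compl.
have CV1 : (C :&: V1 = 0)%VS by rewrite capvC.
have piD v : daddv_pi C V1 v + daddv_pi V1 C v = v.
  by apply: daddv_pi_add => //; rewrite addvC addv_complf memvf.
have piV1 v : v \in V1 -> daddv_pi C V1 v = 0 by exact: daddv_pi_ker.
have [f f_piv] := quot_lift piV1.
pose F v := (piv V1 v, vsproj V1 (daddv_pi V1 C v)).
have F_lin : linear F by move=> a v w; rewrite /F !linearP.
pose FM := GRing.isLinear.Build _ _ _ _ F F_lin.
pose F' : {linear V -> (quotv V1 * subvs_of V1)%type} := HB.pack F FM.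
pose G (xu : (quotv V1 * subvs_of V1)%type) := f xu.1 + vsval xu.2.
have G_lin : linear G by move=> a xu yv; rewrite /G /= !linearP /= scalerDr addrACA.
pose GM := GRing.isLinear.Build _ _ _ _ G G_lin.
pose G' : {linear (quotv V1 * subvs_of V1)%type -> V} := HB.pack G GM.
exists F', G'; split.
- by move=> v; rewrite /= /G /= f_piv vsprojK ?memv_pi //; exact: piD.
- move=> [x u]; have [v <-] := piv_surj x; rewrite /= /F /G /= f_piv.
  congr (_, _).
    apply/eqP; rewrite eq_sym piv_eq -{1}(piD v) opprD addrACA subrr add0r.
    by rewrite rpredB ?memv_pi ?subvsP.
  rewrite linearD /= (daddv_pi_ker V1C) ?memv_pi // add0r.
  by rewrite daddv_pi_id ?subvsP ?vsvalK.
- move=> n U p pP; split; first exact: (dsmooth_piv V1 pP).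
  rewrite /= /sub_plot.
  (* The projection onto [V1] is the identity minus the projection onto [C]; the latter vanishes on
     [V1], so [dsmooth_linear] applies to it. *)
  apply: (plot_ext (p := fun x => p x + (-1) *: daddv_pi C V1 (p x))).
    move=> x _; rewrite /= vsprojK ?memv_pi // scaleN1r -{1}(piD (p x)).
    by rewrite addrAC subrr add0r.
  apply: plotD => //; apply: (plotZ hD (a := fun=> -1)).
    by apply: plot_cst; exact: plot_open pP.
  exact: (dsmooth_linear hD piV1 pP).
- move=> n U p [p1 p2]; apply: (plotD hD); last exact: p2.
  exact: (dsmooth_linear_quot f hD p1).
Qed.

(** The form is pulled back along the smooth linear section [f] of [piv V1] with values in a
    complement. It is definite because g v v = 0 makes [v] isotropic, that is, of class zero. *)
Lemma pseudo_metric_descends (g : {symmetric V}) : is_pseudo_metric D g ->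
  exists2 h : {dot (quotv V1) for idfun},
    smooth_form (quot_diffeology V1 D) h &
    forall v w, h (piv V1 v) (piv V1 w) = g v w.
Proof.
move=> pg; have [sg g_ge0 _] := pg; pose C := (V1^C)%VS.
have CV1 : (C :&: V1 = 0)%VS by rewrite capvC capv_compl.
have piV1 v : v \in V1 -> daddv_pi C V1 v = 0 by exact: daddv_pi_ker.
have [f f_piv] := quot_lift piV1.
have gV1 v w : v \in V1 -> g v w = 0.
  by rewrite (max_isotropic_orthov pg) => /mem_orthovP ->; rewrite ?memvf.
have fV1 v : v - f (piv V1 v) \in V1.
  have vCV1 : v \in (C + V1)%VS by rewrite addvC addv_complf memvf.
  rewrite f_piv -[X in X - _](daddv_pi_add CV1 vCV1) addrAC subrr add0r.
  exact: memv_pi.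
pose h x y := g (f x) (f y).
have h_piv v w : h (piv V1 v) (piv V1 w) = g v w.
  have gf u u' : g (f (piv V1 u)) u' = g u u'.
    have /= := gV1 _ u' (fV1 u); rewrite linearBl /= => /eqP.
    by rewrite subr_eq0 => /eqP.
  by rewrite /h gf sform_sym gf sform_sym.
have h_sym x y : h x y = (-1) ^+ false * idfun (h y x).
  by rewrite expr0 mul1r; exact: sform_sym.
have h_bil : bilinear_for *%R (idfun \; *%R) h.
  split=> x a y z; rewrite /h /=; first by rewrite linearP linearPl.
  by rewrite linearP linearPr.
have h_gt0 x : x != 0 -> 0 < h x x.
  have [v <-] := piv_surj x; rewrite h_piv piv_eq0 lt_def g_ge0 andbT.
  apply: contraNneq => gvv; rewrite (max_isotropic_orthov pg); apply/mem_orthovP => w _.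
  exact: sform_ge0_isotropic.
pose hB := bilinear_isBilinear.Build _ _ _ _ _ _ h h_bil.
pose hH := isHermitianSesquilinear.Build _ _ false idfun h h_sym.
pose hDot := isDotProduct.Build _ _ h h_gt0.
pose h' : {dot (quotv V1) for idfun} := HB.pack h hB hH hDot.
exists h' => // n U p [p1 p2].
by apply: (sg n U (fun x => (f (p x).1, f (p x).2))); split;
  [exact: (dsmooth_linear_quot f hD p1)|exact: (dsmooth_linear_quot f hD p2)].
Qed.
End Linear.
End PseudoMetric.

(** * Characteristic subspaces as complements of the isotropic subspace *)

Section Characteristic.
Context (R : realType) (V : vectType R) (b : (\dim {:V}).-tuple V).
Context (b_basis : basis_of {:V} b).

Lemma coord_col_lin : linear (coord_col b).
Proof. by move=> a v w; apply/colP => i; rewrite !mxE linearP. Qed.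
HB.instance Definition _ := GRing.isLinear.Build _ _ _ _ (coord_col b) coord_col_lin.

Lemma coord_colK v : v = \sum_i coord_col b v i 0 *: b`_i.
Proof.
rewrite {1}(coord_basis b_basis (memvf v)).
by apply: eq_bigr => i _; rewrite mxE.
Qed.

Lemma coord_col_sum (c : 'cV[R]_(\dim {:V})) :
  coord_col b (\sum_i c i 0 *: b`_i) = c.
Proof.
apply/colP => i; rewrite mxE.
exact: (coord_sum_free (fun i => c i 0) i (basis_free b_basis)).
Qed.

Lemma gram_coord (g : {symmetric V}) v w :
  g v w = ((coord_col b v)^T *m gram_mx b g *m coord_col b w) 0 0.
Proof.
rewrite {1}(coord_colK v) {1}(coord_colK w) linear_sumlz -mulmxA mxE.
apply: eq_bigr => i _; rewrite linearZl_LR linear_sumr !mxE /=; congr (_ * _).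
by apply: eq_bigr => j _; rewrite linearZr_LR /= !mxE mulrC.
Qed.

(** The entries of the product are the values g b_i v on a basis. *)
Lemma gram_isotropic (g : {symmetric V}) v :
  (v \in orthov g fullv) = (gram_mx b g *m coord_col b v == 0).
Proof.
apply/mem_orthovP/eqP => [gv|gv w _]; last first.
  by rewrite sform_sym gram_coord -mulmxA gv mulmx0 mxE.
apply/colP => i; rewrite [RHS]mxE -[RHS](gv b`_i (memvf _)) sform_sym.
rewrite {2}(coord_colK v) linear_sumr mxE; apply: eq_bigr => j _.
by rewrite linearZr_LR /= !mxE mulrC.
Qed.

Lemma characteristic_complement (g : {symmetric V}) :
  (forall v, 0 <= g v v) ->
  let C := characteristic_subspace b g in
  (C :&: orthov g fullv = 0)%VS /\ (C + orthov g fullv = fullv)%VS.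
Proof.
move=> g_ge0 C; pose A := gram_mx b g.
have A_sym : A^T = A by apply/matrixP => i j; rewrite !mxE sform_sym.
(* The Euclidean product of the coordinates in [b], for which the Gram matrix is self-adjoint. *)
pose dot (v w : V) : R := ((coord_col b v)^T *m coord_col b w) 0 0.
have dot_lin w : linear (dot^~ w : V -> R^o).
  by move=> a u v; rewrite /dot linearP linearP /= mulmxDl -scalemxAl !mxE.
(* For [A u = l u] and [A v = 0], symmetry gives [l <u, v> = <A u, v> = 0]. *)
have C_dot u v : u \in C -> v \in orthov g fullv -> dot u v = 0.
  rewrite gram_isotropic => + /eqP Av.
  pose dM := GRing.isLinear.Build _ _ _ _ _ (dot_lin v).
  pose d : {linear V -> R^o} := HB.pack (dot^~ v : V -> R^o) dM.
  have : (C <= lker (linfun d))%VS.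
    apply: generatedv_min => w [_ [l l0 Aw]].
    rewrite memv_ker lfunE /= /dot -(inj_eq (mulfI (lt0r_neq0 l0))) mulr0.
    have /(congr1 (fun M => (M^T *m coord_col b v) 0 0)) := Aw.
    rewrite trmx_mul -/A A_sym -mulmxA Av mulmx0 linearZ /= -scalemxAl !mxE.
    by move=> <-.
  by move=> /subvP CK /CK; rewrite memv_ker lfunE => /eqP.
have dot_ge0 v : 0 <= dot v v.
  by rewrite /dot mxE sumr_ge0 // => i _; rewrite mxE -expr2 sqr_ge0.
have dot_eq0 v : dot v v = 0 -> v = 0.
  move=> /eqP; rewrite /dot mxE.
  rewrite psumr_eq0 => [/allP c0|i _]; last by rewrite mxE -expr2 sqr_ge0.
  rewrite (coord_colK v) big1 // => i _.
  have := c0 i (mem_index_enum i); rewrite mxE /= mulf_eq0 orbb => /eqP ->.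
  by rewrite scale0r.
split.
  apply/eqP; rewrite -subv0; apply/subvP => v; rewrite memv_cap memv0.
  by move=> /andP[vC vN]; apply/eqP/dot_eq0/C_dot.
have [P [P_unit [d PA]]] := symmetric_diagonalization A_sym.
(* The rows of [P] are eigenvectors of [A]; as [g] is semipositive, each one lies
   in [C] or in the isotropic subspace. *)
pose u i := \sum_j P i j *: b`_j.
have coord_u i : coord_col b (u i) = (row i P)^T.
  rewrite -[RHS]coord_col_sum; congr (coord_col b _).
  by apply: eq_bigr => j _; rewrite !mxE.
have Au i : A *m coord_col b (u i) = d 0 i *: coord_col b (u i).
  have := congr1 (row i) PA; rewrite !row_mul row_diag_mx -scalemxAl -rowE.
  move=> /(congr1 trmx).
  by rewrite trmx_mul A_sym linearZ /= coord_u.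
have u_mem i : u i \in (C + orthov g fullv)%VS.
  (* This number is g u_i u_i, so the eigenvalue is nonnegative once u_i is nonzero. *)
  have d_ge0 : 0 <= d 0 i * dot (u i) (u i).
    by have := g_ge0 (u i); rewrite gram_coord -mulmxA Au -scalemxAr mxE.
  have [->|u0] := eqVneq (u i) 0; first exact: mem0v.
  have dot_gt0 : 0 < dot (u i) (u i).
    by rewrite lt_def dot_ge0 andbT; apply: contra_neq u0 => /dot_eq0.
  move: d_ge0; rewrite (pmulr_lge0 _ dot_gt0) le_eqVlt => /orP[/eqP d0|d0].
    apply: subvP (addvSr _ _) _ _.
    by rewrite gram_isotropic -/A Au -d0 scale0r.
  apply: subvP (addvSl _ _) _ _; apply: mem_generatedv; split=> //.
  by exists (d 0 i).
apply/vspaceP => v; rewrite memvf.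
(* The rows of the invertible [P] span: c^T = (c^T P^-1) P for the coordinates c of [v]. *)
have -> : v = \sum_i ((coord_col b v)^T *m invmx P) 0 i *: u i.
  rewrite {1}(coord_colK v).
  have {1}-> : coord_col b v = ((coord_col b v)^T *m invmx P *m P)^T.
    by rewrite mulmxKV // trmxK.
  rewrite /u; under [RHS]eq_bigr => i _ do rewrite scaler_sumr.
  rewrite exchange_big; apply: eq_bigr => j _; rewrite 2!mxE scaler_suml.
  by apply: eq_bigr => i _; rewrite scalerA.
by apply: rpred_sum => i _; apply: rpredZ.
Qed.
End Characteristic.

Theorem lemma2p13 (R : realType) (V : vectType R) (D : diffeology R V)
    (hD : is_diffeological_vspace D) :
  [/\ linear_diffeomorphic (quot_diffeology (max_isotropic D) D)
        (dual_diffeology D),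
      forall (b : (\dim {:V}).-tuple V) (g : {symmetric V}),
        basis_of {:V} b -> is_pseudo_metric D g ->
        linear_diffeomorphic (quot_diffeology (max_isotropic D) D)
          (sub_diffeology D (characteristic_subspace b g)),
      linear_diffeomorphic D
        (prod_diffeology (quot_diffeology (max_isotropic D) D)
           (sub_diffeology D (max_isotropic D))) &
      forall g : {symmetric V}, is_pseudo_metric D g ->
        exists2 h : {dot (quotv (max_isotropic D)) for idfun},
          smooth_form (quot_diffeology (max_isotropic D) D) h &
          forall v w, h (piv (max_isotropic D) v) (piv (max_isotropic D) w)
                      = g v w].
Proof.
split.
- exact: quot_diffeomorphic_dual.
- move=> b g b_basis pg; have [_ g_ge0 _] := pg.
  have [C0 CT] := characteristic_complement b_basis g_ge0.
  by apply: (quot_diffeomorphic_complement hD); rewrite (max_isotropic_orthov pg).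
- exact: diffeomorphic_quot_sum.
- exact: pseudo_metric_descends.
Qed.
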